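(* Let $q\in(0,1)$, $j\in\{\tfrac12,1,\tfrac32,\dots\}$ and let $L$ be a positive integer. The process ASEP$(q,j)$ on $\{1,\dots,L\}$ with closed boundary conditions is self-dual with each of the following self-duality functions, defined for $\eta,\xi\in\{0,1,\dots,2j\}^L$: $$D_{(L)}(\eta,\xi)=\prod_{i=1}^L \frac{\binom{\eta_i}{\xi_i}_q}{\binom{2j}{\xi_i}_q}\cdot q^{(\eta_i-\xi_i)\left[2\sum_{k=1}^{i-1}\xi_k+\xi_i\right]+4ji\xi_i}\cdot\mathbf 1_{\xi_i\le\eta_i}$$ and $$D'_{(L)}(\eta,\xi)=\prod_{i=1}^L \frac{\binom{\eta_i}{\xi_i}_q}{\binom{2j}{\xi_i}_q}\cdot q^{(\eta_i-\xi_i)\left[2\sum_{k=1}^{i-1}\eta_k-\eta_i\right]+4ji\xi_i}\cdot\mathbf 1_{\xi_i\le\eta_i}.$$ That is, for $\mathcal D\in\{D_{(L)},D'_{(L)}\}$, all $\eta,\xi\in\{0,\dots,2j\}^L$ and all $t>0$, $\mathbb E_\eta[\mathcal D(\eta(t),\xi)]=\mathbb E_\xi[\mathcal D(\eta,\xi(t))]$, where $(\eta(t))_{t\ge0}$ and $(\xi(t))_{t\ge 0}$ are copies of the process started from $\eta$ and from $\xi$ respectively.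
   Context: For $n\in\mathbb N_0$: $[n]_q=\frac{q^n-q^{-n}}{q-q^{-1}}$, $[n]_q!=[n]_q[n-1]_q\cdots[1]_q$ (with $[0]_q!=1$), and $\binom{n}{k}_q=\frac{[n]_q!}{[k]_q!\,[n-k]_q!}$ for $0\le k\le n$ (a factor with $\xi_i>\eta_i$ is read as $0$). ASEP$(q,j)$ on $\{1,\dots,L\}$ with closed boundary conditions is the continuous-time Markov process on $\{0,1,\dots,2j\}^L$ with generator $(\mathcal L^{(L)}f)(\eta)=\sum_{i=1}^{L-1}(\mathcal L_{i,i+1}f)(\eta)$, where $$(\mathcal L_{i,i+1}f)(\eta)=q^{\eta_i-\eta_{i+1}-(2j+1)}[\eta_i]_q[2j-\eta_{i+1}]_q\,(f(\eta^{i,i+1})-f(\eta))+q^{\eta_i-\eta_{i+1}+(2j+1)}[2j-\eta_i]_q[\eta_{i+1}]_q\,(f(\eta^{i+1,i})-f(\eta)),$$ and $\eta^{i,k}$ denotes the configuration obtained from $\eta$ by moving one particle from site $i$ to site $k$.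
   Formalization: In D' the bracket is taken as 2∑_{k<i}η_k + η_i instead of 2∑_{k<i}η_k − η_i: with the minus sign duality fails, e.g. for L=2, 2j=2, ξ=0, where D'(η,0)=q^{-(η_1-η_2)^2} would have to have constant expectation. *)

(* Defs.v *)
From HB Require Import structures.
From mathcomp Require Import all_boot all_order all_algebra.
From mathcomp Require Import all_classical all_reals all_analysis.
Set Implicit Arguments.
Unset Strict Implicit.
Unset Printing Implicit Defensive.
Import Order.TTheory GRing.Theory Num.Theory.
Import numFieldNormedType.Exports.
Local Open Scope classical_set_scope.
Local Open Scope ring_scope.

Section MarkovProcess.
Context (R : realType) (E : finType) (d : measure_display)
  (Omega : measurableType d).
(* P x is the law of the process started from x, X t is the state at time t;
   only the times t >= 0 are constrained below. *)
Variables (P : E -> probability Omega R) (X : R -> Omega -> E).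

(* Generators of the natural filtration at time s. *)
Definition past (s : R) : set_system Omega :=
  [set A | exists u z, 0 <= u <= s /\ A = [set w | X u w = z]].

(* Path regularity is not required: the law of the process on a finite state
   space is determined by the conditions below. *)
Record markov_process : Prop := MarkovProcess {
  markov_measurable : forall t z, 0 <= t -> measurable [set w | X t w = z];
  markov_start : forall x, P x [set w | X 0 w = x] = 1%E;
  markov_property : forall x s t A y z, 0 <= s -> 0 <= t -> <<s past s >> A ->
    P x (A `&` [set w | X s w = y] `&` [set w | X (s + t) w = z])
    = (P x (A `&` [set w | X s w = y]) * P y [set w | X t w = z])%E
}.

Definition has_generator (G : (E -> R) -> E -> R) : Prop :=
  forall (f : E -> R) (x : E),
    (fine ('E_(P x)[fun w => f (X t w)])%E - f x) / t @[t --> 0^'+] --> G f x.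

End MarkovProcess.

(* The copies (P, X) and (P', X') may live on different probability spaces. *)
Definition duality_function (R : realType) (E : finType)
    (d : measure_display) (Omega : measurableType d)
    (P : E -> probability Omega R) (X : R -> Omega -> E)
    (d' : measure_display) (Omega' : measurableType d')
    (P' : E -> probability Omega' R) (X' : R -> Omega' -> E)
    (D : E -> E -> R) : Prop :=
  forall (eta xi : E) (t : R), 0 < t ->
    ('E_(P eta)[fun w => D (X t w) xi] = 'E_(P' xi)[fun w => D eta (X' t w)])%E.

Section QNumbers.
Context (R : realType) (q : R).

Definition qnum (n : nat) : R := (q ^+ n - q ^- n) / (q - q^-1).

Definition qfact (n : nat) : R := \prod_(1 <= k < n.+1) qnum k.

(* Only meaningful for k <= n. *)
Definition qbinom (n k : nat) : R := qfact n / (qfact k * qfact (n - k)).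

End QNumbers.

(* Throughout, J stands for 2j, so that j ranges over 1/2, 1, 3/2, ... when J
   ranges over the positive integers; sites are numbered from 0, so that the
   ordinal i is the site i + 1. *)
Section ASEP.
Context (R : realType) (q : R) (J L : nat).

Definition config := {ffun 'I_L -> 'I_J.+1}.

(* When site i is empty or site k is full the move is impossible (its rate
   below is 0) and move eta i k is eta. *)
Definition move (eta : config) (i k : 'I_L) : config :=
  if (0 < eta i)%N && (eta k < J)%N then
    [ffun l => if l == i then inord (eta i).-1
               else if l == k then inord (eta k).+1
               else eta l]
  else eta.

Definition bond_generator (i k : 'I_L) (f : config -> R) (eta : config) : R :=
  q ^ ((eta i)%:Z - (eta k)%:Z - J.+1%:Z)
    * qnum q (eta i) * qnum q (J - eta k) * (f (move eta i k) - f eta)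
  + q ^ ((eta i)%:Z - (eta k)%:Z + J.+1%:Z)
    * qnum q (J - eta i) * qnum q (eta k) * (f (move eta k i) - f eta).

Definition asep_generator (f : config -> R) (eta : config) : R :=
  \sum_(i < L) \sum_(k < L | k == i.+1 :> nat) bond_generator i k f eta.

Definition dual_D (eta xi : config) : R :=
  \prod_(i < L)
    (qbinom q (eta i) (xi i) / qbinom q J (xi i)
     * q ^ (((eta i)%:Z - (xi i)%:Z)
              * (2 * (\sum_(k < L | (k < i)%N) (xi k)%:Z) + (xi i)%:Z)
            + 2 * J%:Z * i.+1%:Z * (xi i)%:Z)
     * (xi i <= eta i)%N%:R).

(* The bracket is 2 * (sum of eta k over k < i) PLUS eta i.  With minus eta i,
   a sign found in print, duality fails as soon as J >= 2 and L >= 2: for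
   J = L = 2 and xi = 0 the function would be
   q ^ (2 eta_1 eta_2 - eta_1 ^ 2 - eta_2 ^ 2), whose expectation would have to
   be constant in time, but it is 1 at (1, 1) and q ^ (- 4) > 1 at the other
   configurations with two particles. *)
Definition dual_D' (eta xi : config) : R :=
  \prod_(i < L)
    (qbinom q (eta i) (xi i) / qbinom q J (xi i)
     * q ^ (((eta i)%:Z - (xi i)%:Z)
              * (2 * (\sum_(k < L | (k < i)%N) (eta k)%:Z) + (eta i)%:Z)
            + 2 * J%:Z * i.+1%:Z * (xi i)%:Z)
     * (xi i <= eta i)%N%:R).

End ASEP.

(* Main.v *)
(* Both assertions reduce to the duality of the generator,
   (L D(., xi))(eta) = (L D(eta, .))(xi).

   Up to powers of q, [dual_D] is the product of the site weights
   fall(eta_i, xi_i) / fall(2j, xi_i), where fall(n, k) = [n]_q ... [n-k+1]_q.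
   Moving a particle across a bond changes only the two weights of the bond and
   multiplies the power of q by q^(xi_i + xi_(i+1)), q^(4j - eta_i - eta_(i+1))
   or an inverse of these, so that duality holds bond by bond, as a rational
   identity in q^eta_i, q^eta_(i+1), q^xi_i, q^xi_(i+1), q^(2j).  Moreover
   D' = q^((|eta| - |xi|)^2) D, and the numbers of particles are conserved.

   From generators to processes: for transition semigroups S_t and S'_t, the
   defect S_t D - D S'_t^T is o(t) at 0.  Over n steps of length t / n the
   semigroup property and the contraction of stochastic matrices add the defects
   up to n o(t / n), which tends to 0; no differential equation is needed. *)
Require Import Defs.
From HB Require Import structures.
From mathcomp Require Import all_boot all_order all_algebra.
From mathcomp Require Import all_classical all_reals all_analysis.
From mathcomp Require Import ring zify.
Set Implicit Arguments.
Unset Strict Implicit.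
Unset Printing Implicit Defensive.
Import Order.TTheory GRing.Theory Num.Theory.
Import numFieldNormedType.Exports.
Local Open Scope classical_set_scope.
Local Open Scope ring_scope.

(** * q-integers and q-falling factorials with an integer argument *)

Section QFalling.
Context (R : realType) (q : R).

(** [qnum] is extended to integers because n - k and n + 1 - k occur below with n < k, where
    truncated subtraction would break the identities. *)
Definition qint (z : int) : R := (q ^ z - q ^ (- z)) / (q - q^-1).

Definition qfall (n : int) (k : nat) : R := \prod_(i < k) qint (n - i%:Z).

Lemma qint0 : qint 0 = 0.
Proof. by rewrite /qint oppr0 subrr mul0r. Qed.

Lemma qfall0 n : qfall n 0 = 1.
Proof. by rewrite /qfall big_ord0. Qed.

Lemma qfallSr n k : qfall n k.+1 = qfall n k * qint (n - k%:Z).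
Proof. by rewrite /qfall big_ord_recr. Qed.

Lemma qfallSl n k : qfall n k.+1 = qint n * qfall (n - 1) k.
Proof.
rewrite /qfall big_ord_recl subr0; congr (_ * _).
by apply: eq_bigr => i _; rewrite lift0 intS opprD addrA.
Qed.

Lemma qfall_small (n k : nat) : (n < k)%N -> qfall n%:Z k = 0.
Proof.
by move=> nk; rewrite /qfall (bigD1 (Ordinal nk)) //= subrr qint0 mul0r.
Qed.

Lemma qnumE (n : nat) : qnum q n = qint n%:Z.
Proof. by rewrite /qnum /qint exprnN. Qed.

Hypothesis hq : 0 < q < 1.

Let q_gt0 : 0 < q. Proof. by case/andP: hq. Qed.
Let q_neq0 : q != 0. Proof. by rewrite gt_eqF. Qed.

(** For q positive and different from 1, z -> q^z is injective on integers, so q^z = q^(-z) forces z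
    = 0. *)
Lemma qint_neq0 (z : int) : z != 0 -> qint z != 0.
Proof.
have q1 : q != 1 by case/andP: hq => _; rewrite lt_neqAle => /andP[].
have inj := ieexprIz q_gt0 q1.
have e_neq (y : int) : y != 0 -> q ^ y - q ^ (- y) != 0.
  by move=> y0; rewrite subr_eq0; apply/eqP => /inj; lia.
move=> z0; rewrite /qint mulf_neq0 ?e_neq // invr_eq0.
(* The denominator [q - q^-1] is the numerator at z = 1. *)
by have := e_neq 1 isT; rewrite expr1z exprN1.
Qed.

Lemma qfact_neq0 n : qfact q n != 0.
Proof.
rewrite /qfact big_add1 big_mkord prodf_seq_neq0; apply/allP => k _ /=.
by rewrite qnumE qint_neq0.
Qed.

Lemma qfall_neq0 (n k : nat) : (k <= n)%N -> qfall n%:Z k != 0.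
Proof.
move=> kn; rewrite /qfall prodf_seq_neq0; apply/allP => i _ /=.
by apply: qint_neq0; have := ltn_ord i; lia.
Qed.

Lemma qfact_qfall (n k : nat) :
  (k <= n)%N -> qfact q n = qfall n%:Z k * qfact q (n - k).
Proof.
elim: k => [|k IHk] kn; first by rewrite qfall0 mul1r subn0.
rewrite IHk 1?ltnW // qfallSr -mulrA; congr (_ * _).
rewrite subzn 1?ltnW // -qnumE -(subnSK kn) /qfact big_nat_recr //=.
by rewrite mulrC.
Qed.

Lemma qbinomE (n k : nat) : (k <= n)%N -> qbinom q n k = qfall n%:Z k / qfact q k.
Proof.
move=> kn; rewrite /qbinom (qfact_qfall kn).
have := qfact_neq0 k; have := qfact_neq0 (n - k) => a0 b0.
by field; rewrite a0 b0.
Qed.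

(** * Site weights under a unit shift of either argument *)

Section Weight.
Variable J : nat.

Definition weight (n : int) (k : nat) : R := qfall n k / qfall J%:Z k.

(** [qfact q k] cancels in the quotient of binomials; for n < k the factor [qint 0] of [qfall n k]
    does the work of the indicator. *)
Lemma qbinom_ratioE (n k : nat) : (k <= J)%N ->
  qbinom q n k / qbinom q J k * (k <= n)%N%:R = weight n%:Z k.
Proof.
move=> kJ; case: leqP => [kn|nk]; last by rewrite mulr0 /weight qfall_small ?mul0r.
rewrite !qbinomE // mulr1 /weight.
by field; rewrite qfact_neq0 qfall_neq0.
Qed.

(* The quotient [weight n k / qint (n + 1 - k)], written so that it also makes
   sense for [k = n + 1]: every term of the duality relation of a bond is a
   multiple of it, so that no boundary case has to be treated apart. *)
Definition pre_weight (n : int) (k : nat) : R :=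
  qfall (n + 1) k / qint (n + 1) / qfall J%:Z k.

(** [qfall (n + 1) k.+1] is computed twice, splitting off its last or its first factor. *)
Lemma weight_pre (n k : nat) :
  weight n%:Z k = pre_weight n%:Z k * qint (n%:Z + 1 - k%:Z).
Proof.
rewrite /weight /pre_weight.
have e : qfall (n%:Z + 1) k * qint (n%:Z + 1 - k%:Z)
    = qint (n%:Z + 1) * qfall n%:Z k.
  by rewrite -qfallSr qfallSl addrK.
have n0 : qint (n%:Z + 1) != 0 by apply: qint_neq0.
by rewrite mulrAC (mulrAC (qfall _ _)) e (mulrC (qint _)) mulfK.
Qed.

(** [qint n] completes [qfall (n - 1) k] to [qfall n k.+1]. At n = 0 this shows that the right side
    vanishes, which serves for an empty site. *)
Lemma weight_pred (n k : nat) :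
  qint n%:Z * weight (n%:Z - 1) k
  = pre_weight n%:Z k * qint (n%:Z + 1 - k%:Z) * qint (n%:Z - k%:Z).
Proof.
by rewrite -weight_pre /weight mulrA -qfallSl qfallSr mulrAC.
Qed.

Lemma weight_succ (n k : nat) :
  weight (n%:Z + 1) k = qint (n%:Z + 1) * pre_weight n%:Z k.
Proof.
by rewrite /weight /pre_weight mulrA [X in _ = X / _]mulrC divfK // qint_neq0.
Qed.

Lemma weight_lower (n k : nat) : (k < J)%N ->
  weight n%:Z k = pre_weight n%:Z k.+1 * qint (J%:Z + 1 - k.+1%:Z).
Proof.
move=> kJ; rewrite /weight /pre_weight qfallSl addrK qfallSr.
have -> : J%:Z + 1 - k.+1%:Z = J%:Z - k%:Z by lia.
have a0 : qint (J%:Z - k%:Z) != 0 by apply: qint_neq0; lia.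
have b0 : qint (n%:Z + 1) != 0 by apply: qint_neq0.
have c0 : qfall J%:Z k != 0 by rewrite qfall_neq0 // ltnW.
by field; rewrite a0 b0 c0.
Qed.

Lemma weight_raise (n k : nat) : (k < J)%N ->
  qint (J%:Z - k%:Z) * weight n%:Z k.+1
  = pre_weight n%:Z k * qint (n%:Z + 1 - k%:Z) * qint (n%:Z - k%:Z).
Proof.
move=> kJ; rewrite -weight_pre /weight !qfallSr.
have a0 : qint (J%:Z - k%:Z) != 0 by apply: qint_neq0; lia.
have c0 : qfall J%:Z k != 0 by rewrite qfall_neq0 // ltnW.
by field; rewrite a0 c0.
Qed.

(** Up to the denominator this is [qfall n J.+1], zero for n <= J. It serves for jumps of the dual
    onto a full site. *)
Lemma pre_weight_full (n : nat) : (n <= J)%N ->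
  pre_weight n%:Z J * qint (n%:Z + 1 - J%:Z) * qint (n%:Z - J%:Z) = 0.
Proof.
move=> nJ; rewrite -weight_pre /weight mulrAC -qfallSr.
by rewrite qfall_small ?mul0r.
Qed.

End Weight.
End QFalling.

(** * The rational identity behind the duality of one bond *)

Lemma two_site_identity (F : fieldType) (q A B C E Q : F) :
  q != 0 -> A != 0 -> B != 0 -> C != 0 -> E != 0 -> Q != 0 -> q - q^-1 != 0 ->
  let n x := (x - x^-1) / (q - q^-1) in
  A / B / (q * Q) *
    (n (Q / B) * n (B * q) * n (A * q / C) * n (A / C) * (C * E)
     - n A * n (Q / B) * (n (A * q / C) * n (B * q / E)))
  + A / B * (q * Q) *
    (n (Q / A) * n (A * q) * n (B * q / E) * n (B / E) / (C * E)
     - n (Q / A) * n B * (n (A * q / C) * n (B * q / E)))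
  = C / E / (q * Q) *
    (n C * n (Q * q / C) * n (B * q / E) * n (B / E) * (Q ^+ 2 / (A * B))
     - n C * n (Q / E) * (n (A * q / C) * n (B * q / E)))
  + C / E * (q * Q) *
    (n E * n (Q * q / E) * n (A * q / C) * n (A / C) / (Q ^+ 2 / (A * B))
     - n (Q / C) * n E * (n (A * q / C) * n (B * q / E))).
Proof.
move=> q0 A0 B0 C0 E0 Q0 + n.
have -> : q - q^-1 = (q ^+ 2 - 1) / q by field.
rewrite mulf_eq0 invr_eq0 negb_or => /andP[q1 _].
have nE x : n x = (x ^+ 2 - 1) / (q^+2 - 1) * q / x.
  (* At x = 0 both sides are 0 by the convention 0^-1 = 0, so that [nE] rewrites at every
     argument. *)
  rewrite /n; have [->|x0] := eqVneq x 0.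
    by rewrite invr0 !mulr0 subr0 mul0r.
  field. by rewrite x0 q1 q0.
rewrite !nE; field.
by rewrite ?q0 ?A0 ?B0 ?C0 ?E0 ?Q0 ?q1.
Qed.

(** This is [two_site_identity] at A = q^a, B = q^b, C = q^c, E = q^e, Q = q^j, where (a, b) and (c,
    e) are the occupations of the bond in [eta] and [xi]. *)
Lemma two_site_duality (R : realType) (q : R) (a b c e j : int) : 0 < q < 1 ->
  q ^ (a - b - (1 + j)) *
    (qint q (j - b) * qint q (b + 1) * qint q (a + 1 - c) * qint q (a - c)
       * q ^ (c + e)
     - qint q a * qint q (j - b) * (qint q (a + 1 - c) * qint q (b + 1 - e)))
  + q ^ (a - b + (1 + j)) *
    (qint q (j - a) * qint q (a + 1) * qint q (b + 1 - e) * qint q (b - e)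
       * q ^ (- (c + e))
     - qint q (j - a) * qint q b * (qint q (a + 1 - c) * qint q (b + 1 - e)))
  = q ^ (c - e - (1 + j)) *
    (qint q c * qint q (j + 1 - c) * qint q (b + 1 - e) * qint q (b - e)
       * q ^ (2 * j - (a + b))
     - qint q c * qint q (j - e) * (qint q (a + 1 - c) * qint q (b + 1 - e)))
  + q ^ (c - e + (1 + j)) *
    (qint q e * qint q (j + 1 - e) * qint q (a + 1 - c) * qint q (a - c)
       * q ^ (- (2 * j - (a + b)))
     - qint q (j - c) * qint q e * (qint q (a + 1 - c) * qint q (b + 1 - e))).
Proof.
move=> hq.
have q0 : q != 0 by case/andP: hq => /gt_eqF ->.
have qq0 : q - q^-1 != 0.
  by have := qint_neq0 hq (z := 1) isT; rewrite /qint mulf_eq0 expr1z exprN1; case: eqP.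
have X0 (z : int) : q ^ z != 0 by rewrite expfz_neq0.
have XD (x y : int) : q ^ (x + y) = q ^ x * q ^ y by rewrite expfzDr.
have XN (x : int) : q ^ (- x) = (q ^ x)^-1 by rewrite invr_expz.
have X2 (x : int) : q ^ (2 * x) = (q ^ x) ^+ 2.
  by rewrite (_ : 2 * x = x + x) ?XD; [rewrite expr2 | ring].
have := two_site_identity q0 (X0 a) (X0 b) (X0 c) (X0 e) (X0 j) qq0.
rewrite /qint; cbv zeta.
have X1 : q ^ (1 : int) = q by rewrite expr1z.
do ![rewrite XN | rewrite XD | rewrite X2 | rewrite X1].
move: (q ^ a) (q ^ b) (q ^ c) (q ^ e) (q ^ j).
by [].
Qed.

(** * The bilinear form in the exponent of q *)

Section OrderWeight.
Variable L : nat.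

(** Writes the brackets of the duality functions as sums over all sites. The diagonal value 1 gives
    [order_weight l i + order_weight i l = 2]. *)
Definition order_weight (l i : 'I_L) : int := (2 * (l < i) + (l == i :> nat))%N%:Z.

Lemma sum_order_weight (z : 'I_L -> int) (i : 'I_L) :
  \sum_l z l * order_weight l i = 2 * (\sum_(k < L | (k < i)%N) z k) + z i.
Proof.
transitivity (\sum_(l < L) (2 * (if (l < i)%N then z l else 0)
                             + (if l == i then z l else 0))).
  by apply: eq_bigr => l _; rewrite /order_weight -[l == i]/(l == i :> nat);
    do 2!case: ifP => _; lia.
by rewrite big_split -mulr_sumr -!big_mkcond big_pred1_eq.
Qed.

(** Exchanging the two indices leaves the sum unchanged and swaps the arguments of [order_weight];
    the two versions add up to twice the square. *)
Lemma sqr_sum_order_weight (z : 'I_L -> int) :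
  (\sum_i z i) ^+ 2 = \sum_i z i * \sum_l z l * order_weight l i.
Proof.
set T := RHS; have TE : T = \sum_i \sum_l z i * z l * order_weight l i.
  by apply: eq_bigr => i _; rewrite mulr_sumr; apply: eq_bigr => l _; rewrite mulrA.
have TE' : T = \sum_i \sum_l z i * z l * order_weight i l.
  rewrite TE exchange_big; apply: eq_bigr => i _; apply: eq_bigr => l _.
  by rewrite [z l * _]mulrC.
suff : T + T = 2 * (\sum_i z i) ^+ 2 by lia.
rewrite {1}TE TE' -big_split expr2 big_distrlr mulr_sumr; apply: eq_bigr => i _.
rewrite -big_split mulr_sumr; apply: eq_bigr => l _ /=.
rewrite -mulrDr mulrC; congr (_ * _); rewrite /order_weight; lia.
Qed.

Lemma sum_transfer (F z : 'I_L -> int) (i k : 'I_L) :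
  \sum_l F l * (z l - (l == i)%:Z + (l == k)%:Z)
  = \sum_l F l * z l - F i + F k.
Proof.
have delta j : \sum_l F l * (l == j)%:Z = F j.
  rewrite (bigD1 j) //= eqxx mulr1 big1 ?addr0 // => l /negbTE ->; exact: mulr0.
transitivity (\sum_l (F l * z l - F l * (l == i)%:Z + F l * (l == k)%:Z)).
  by apply: eq_bigr => l _; rewrite mulrDr mulrBr.
by rewrite big_split /= sumrB !delta.
Qed.

End OrderWeight.

Lemma prod_exprz (F : fieldType) (I : finType) (q : F) (e : I -> int) :
  q != 0 -> \prod_i q ^ e i = q ^ \sum_i e i.
Proof.
move=> q0; apply: esym; apply: (big_morph (fun z : int => q ^ z)) => //.
by move=> x y; rewrite expfzDr.
Qed.

(** * Effect of a move on the exponent of q *)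

Section Configurations.
Context (J L : nat).
Implicit Types (eta xi : config J L) (i k : 'I_L).

Lemma config_le eta i : (eta i <= J)%N.
Proof. by rewrite -ltnS. Qed.

Lemma moveE eta i k (l : 'I_L) : i != k -> (0 < eta i)%N -> (eta k < J)%N ->
  (move eta i k l)%:Z = (eta l)%:Z - (l == i)%:Z + (l == k)%:Z.
Proof.
move=> ik a0 bJ; rewrite /move a0 bJ /= ffunE.
have [->|li] := eqVneq l i.
  rewrite inordK; last by rewrite ltnS (leq_trans (leq_pred _)) ?config_le.
  by rewrite (negbTE ik); lia.
case: eqVneq => [->|_]; last by rewrite /=; lia.
by rewrite inordK //=; lia.
Qed.

Lemma move_id eta i k : ~~ ((0 < eta i)%N && (eta k < J)%N) -> move eta i k = eta.
Proof. by rewrite /move => /negbTE ->. Qed.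

Lemma sum_move eta i k : i != k ->
  \sum_l (move eta i k l)%:Z = \sum_l (eta l)%:Z.
Proof.
move=> ik; case: (boolP ((0 < eta i)%N && (eta k < J)%N));
  last by move/move_id->.
case/andP=> a0 bJ.
under eq_bigr do rewrite moveE // -[_ + _]mul1r.
by rewrite sum_transfer subrK; apply: eq_bigr => l _; rewrite mul1r.
Qed.

(* The exponent of q in [dual_D], with the products xi_i xi_k collected into a
   square, so that it is bilinear up to conserved quantities. *)
Definition expo eta xi : int :=
  \sum_i ((eta i)%:Z * \sum_l (xi l)%:Z * order_weight l i)
  - (\sum_i (xi i)%:Z) ^+ 2
  + 2 * J%:Z * \sum_(i < L) i.+1%:Z * (xi i)%:Z.

Lemma expo_move_l eta xi i k : i != k -> (0 < eta i)%N -> (eta k < J)%N ->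
  expo (move eta i k) xi = expo eta xi
    - \sum_l (xi l)%:Z * order_weight l i + \sum_l (xi l)%:Z * order_weight l k.
Proof.
move=> ik a0 bJ; rewrite /expo.
under eq_bigr do rewrite moveE // mulrC.
rewrite sum_transfer; under eq_bigr do rewrite mulrC.
ring.
Qed.

(** The squared particle number is conserved; the last term comes from the displacement of the
    particle in the linear part of [expo]. *)
Lemma expo_move_r eta xi i k : i != k -> (0 < xi i)%N -> (xi k < J)%N ->
  expo eta (move xi i k) = expo eta xi
    - \sum_l (eta l)%:Z * order_weight i l + \sum_l (eta l)%:Z * order_weight k l
    + 2 * J%:Z * (k%:Z - i%:Z).
Proof.
move=> ik c0 eJ; rewrite /expo sum_move //.
have -> : \sum_(l < L) l.+1%:Z * (move xi i k l)%:Z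
    = \sum_(l < L) l.+1%:Z * (xi l)%:Z - i.+1%:Z + k.+1%:Z.
  by rewrite -sum_transfer; under eq_bigr do rewrite moveE //.
have -> : \sum_j ((eta j)%:Z * \sum_l (move xi i k l)%:Z * order_weight l j)
   = \sum_j ((eta j)%:Z * \sum_l (xi l)%:Z * order_weight l j)
    - \sum_l (eta l)%:Z * order_weight i l + \sum_l (eta l)%:Z * order_weight k l.
  rewrite -sumrB -big_split /=; apply: eq_bigr => j _.
  under eq_bigr do rewrite moveE // mulrC.
  rewrite sum_transfer; under eq_bigr do rewrite mulrC.
  ring.
by rewrite !intS; ring.
Qed.

(** From i to its neighbour k, the sum over earlier sites gains only site i. Hence the exponent
    changes by occupations of the bond alone. *)
Lemma order_weight_succ (z : 'I_L -> int) i k : k = i.+1 :> nat ->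
  \sum_l z l * order_weight l k = \sum_l z l * order_weight l i + z i + z k.
Proof.
move=> ki; rewrite !sum_order_weight (bigD1 i) /=; last by rewrite ki.
rewrite [X in 2 * (_ + X)](_ : _ = \sum_(l < L | (l < i)%N) z l); first by ring.
by apply: eq_bigl => l; rewrite -(inj_eq val_inj) /=; lia.
Qed.

Lemma order_weight_pred (z : 'I_L -> int) i k : k = i.+1 :> nat ->
  \sum_l z l * order_weight i l = \sum_l z l * order_weight k l + z i + z k.
Proof.
move=> ki.
have o (j l : 'I_L) : order_weight j l = 2 - order_weight l j.
  by rewrite /order_weight; lia.
under eq_bigr do rewrite o mulrBr.
under [in RHS]eq_bigr do rewrite o mulrBr.
rewrite !sumrB (order_weight_succ z ki); ring.
Qed.

(** * Duality of the generator, bond by bond *)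

Section Duality.
Context (R : realType) (q : R).
Hypothesis hq : 0 < q < 1.
Let q_neq0 : q != 0. Proof. by case/andP: hq => /gt_eqF ->. Qed.

Local Notation qi := (qint q).

(** With [zeta] equal to [xi] this is [dual_D], with [zeta] equal to [eta] it is [dual_D']. *)
Lemma dual_prodE eta xi (zeta : config J L) :
  \prod_(i < L)
    (qbinom q (eta i) (xi i) / qbinom q J (xi i)
     * q ^ (((eta i)%:Z - (xi i)%:Z)
              * (2 * (\sum_(k < L | (k < i)%N) (zeta k)%:Z) + (zeta i)%:Z)
            + 2 * J%:Z * i.+1%:Z * (xi i)%:Z)
     * (xi i <= eta i)%N%:R)
  = (\prod_i weight q J (eta i)%:Z (xi i))
    * q ^ (\sum_i (((eta i)%:Z - (xi i)%:Z) * \sum_l (zeta l)%:Z * order_weight l i)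
           + 2 * J%:Z * \sum_(i < L) i.+1%:Z * (xi i)%:Z).
Proof.
rewrite mulr_sumr -big_split /= -prod_exprz // -big_split /=.
apply: eq_bigr => i _; rewrite sum_order_weight mulrAC qbinom_ratioE ?config_le //.
by rewrite mulrA.
Qed.

Lemma dual_DE eta xi :
  dual_D q eta xi = (\prod_i weight q J (eta i)%:Z (xi i)) * q ^ expo eta xi.
Proof.
rewrite /dual_D dual_prodE; congr (_ * q ^ (_ + _)).
rewrite sqr_sum_order_weight -sumrB; apply: eq_bigr => i _; ring.
Qed.

(** The exponents differ by the form of [sqr_sum_order_weight] at z = eta - xi. *)
Lemma dual_D'E eta xi :
  dual_D' q eta xi
  = q ^ ((\sum_i (eta i)%:Z - \sum_i (xi i)%:Z) ^+ 2) * dual_D q eta xi.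
Proof.
rewrite /dual_D /dual_D' !dual_prodE mulrCA; congr (_ * _); rewrite -expfzDr //.
congr (q ^ _); rewrite addrA; congr (_ + _).
rewrite -sumrB sqr_sum_order_weight -big_split; apply: eq_bigr => i _ /=.
under [in RHS]eq_bigr do rewrite mulrBl.
rewrite sumrB; ring.
Qed.

(** Common factor of all terms in the duality relation of the bond, powers of q aside. *)
Definition bond_weight eta xi i k : R :=
  pre_weight q J (eta i)%:Z (xi i) * pre_weight q J (eta k)%:Z (xi k)
  * \prod_(l | (l != i) && (l != k)) weight q J (eta l)%:Z (xi l).

Lemma bond_weightC eta xi i k : bond_weight eta xi i k = bond_weight eta xi k i.
Proof.
by rewrite /bond_weight [pre_weight _ _ _ _ * _]mulrC; under eq_bigl do rewrite andbC.
Qed.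

Lemma prod_bond (w : 'I_L -> R) i k : i != k ->
  \prod_l w l = w i * w k * \prod_(l | (l != i) && (l != k)) w l.
Proof.
by move=> ik; rewrite (bigD1 i) //= (bigD1 k) 1?eq_sym //= mulrA.
Qed.

Lemma prod_weight_bond eta xi i k : i != k ->
  \prod_l weight q J (eta l)%:Z (xi l)
  = bond_weight eta xi i k * qi ((eta i)%:Z + 1 - (xi i)%:Z)
    * qi ((eta k)%:Z + 1 - (xi k)%:Z).
Proof.
move=> ik; rewrite (prod_bond _ ik) !(weight_pre hq) /bond_weight; ring.
Qed.

Lemma prod_weight_move_l eta xi i k : i != k ->
  (0 < eta i)%N -> (eta k < J)%N ->
  qi (eta i)%:Z * \prod_l weight q J (move eta i k l)%:Z (xi l)
  = bond_weight eta xi i k * qi ((eta i)%:Z + 1 - (xi i)%:Z)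
    * qi ((eta i)%:Z - (xi i)%:Z) * qi ((eta k)%:Z + 1).
Proof.
move=> ik a0 bJ.
have mi : (move eta i k i)%:Z = (eta i)%:Z - 1.
  by rewrite moveE // eqxx (negbTE ik) addr0.
have mk : (move eta i k k)%:Z = (eta k)%:Z + 1.
  by rewrite moveE // eqxx eq_sym (negbTE ik) subr0.
rewrite (prod_bond _ ik) mi mk (weight_succ hq) 2!(mulrA (qi (eta i)%:Z)).
rewrite (weight_pred hq).
rewrite [X in _ * X](_ : _ =
  \prod_(l | (l != i) && (l != k)) weight q J (eta l)%:Z (xi l)).
  by rewrite /bond_weight; ring.
apply: eq_bigr => l /andP[li lk]; rewrite moveE //.
by rewrite (negbTE li) (negbTE lk) subr0 addr0.
Qed.

Lemma prod_weight_move_r eta xi i k : i != k ->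
  (0 < xi i)%N -> (xi k < J)%N ->
  qi (J%:Z - (xi k)%:Z) * \prod_l weight q J (eta l)%:Z (move xi i k l)
  = bond_weight eta xi i k * qi ((eta k)%:Z + 1 - (xi k)%:Z)
    * qi ((eta k)%:Z - (xi k)%:Z) * qi (J%:Z + 1 - (xi i)%:Z).
Proof.
move=> ik c0 eJ.
have mi : move xi i k i = (xi i).-1 :> nat.
  by apply/eqP; rewrite -eqz_nat moveE // eqxx (negbTE ik); lia.
have mk : move xi i k k = (xi k).+1 :> nat.
  by apply/eqP; rewrite -eqz_nat moveE // eqxx [k == i]eq_sym (negbTE ik); lia.
have iJ : ((xi i).-1 < J)%N by rewrite prednK ?config_le.
rewrite (prod_bond _ ik) mi mk (weight_lower hq _ iJ) prednK //.
rewrite [X in _ * (_ * X)](_ : _ =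
  \prod_(l | (l != i) && (l != k)) weight q J (eta l)%:Z (xi l)).
  have e := weight_raise hq (eta k) eJ; rewrite /bond_weight.
  set x := qi (J%:Z - _) in e *; rewrite (mulrA x) (mulrCA x) e.
  ring.
apply: eq_bigr => l /andP[li lk]; congr weight.
by apply/eqP; rewrite -eqz_nat moveE // (negbTE li) (negbTE lk) subr0 addr0.
Qed.

(** [s] is the change of the exponent, kept free to serve both jump directions. Where the jump is
    blocked both sides are 0: by [weight_pred] if site [i] is empty, by [qi 0] if site [k] is
    full. *)
Lemma rate_dual_D_l eta xi i k (s : int) : i != k ->
  \sum_l (xi l)%:Z * order_weight l k = \sum_l (xi l)%:Z * order_weight l i + s ->
  qi (eta i)%:Z * qi (J%:Z - (eta k)%:Z) * dual_D q (move eta i k) xi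
  = bond_weight eta xi i k * q ^ expo eta xi
    * (qi (J%:Z - (eta k)%:Z) * qi ((eta k)%:Z + 1)
       * qi ((eta i)%:Z + 1 - (xi i)%:Z) * qi ((eta i)%:Z - (xi i)%:Z) * q ^ s).
Proof.
move=> ik es.
have [a0|a0] := posnP (eta i).
  have := weight_pred hq J (eta i) (xi i); rewrite a0 qint0 !mul0r => e.
  rewrite /bond_weight a0; set x := pre_weight _ _ _ (xi i) in e *.
  set y := qi (0 + 1 - _) in e *; set z := qi (0 - _) in e *.
  rewrite [RHS](_ : _ = x * y * z * (pre_weight q J (eta k)%:Z (xi k)
    * (\prod_(l | (l != i) && (l != k)) weight q J (eta l)%:Z (xi l))
    * q ^ expo eta xi * qi (J%:Z - (eta k)%:Z) * qi ((eta k)%:Z + 1) * q ^ s)).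
    by rewrite -e !mul0r.
  by ring.
have [bJ|] := ltnP (eta k) J; last first.
  move=> Jb; have -> : (eta k)%:Z = J%:Z by have := config_le eta k; lia.
  by rewrite subrr qint0 !(mulr0, mul0r).
have e := prod_weight_move_l xi ik a0 bJ.
rewrite dual_DE expo_move_l // es.
rewrite (_ : _ - _ + _ = expo eta xi + s); last by ring.
rewrite expfzDr //.
set A := qi (eta i)%:Z in e *; set W := \prod_l _ in e *.
transitivity (A * W * (qi (J%:Z - (eta k)%:Z) * (q ^ expo eta xi * q ^ s))).
  by ring.
by rewrite e; ring.
Qed.

Lemma rate_dual_D_r eta xi i k (s : int) : i != k ->
  \sum_l (eta l)%:Z * order_weight k l + 2 * J%:Z * (k%:Z - i%:Z)
  = \sum_l (eta l)%:Z * order_weight i l + s ->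
  qi (xi i)%:Z * qi (J%:Z - (xi k)%:Z) * dual_D q eta (move xi i k)
  = bond_weight eta xi i k * q ^ expo eta xi
    * (qi (xi i)%:Z * qi (J%:Z + 1 - (xi i)%:Z)
       * qi ((eta k)%:Z + 1 - (xi k)%:Z) * qi ((eta k)%:Z - (xi k)%:Z) * q ^ s).
Proof.
move=> ik es.
have [c0|c0] := posnP (xi i); first by rewrite c0 qint0 !(mulr0, mul0r).
(* On a full target site the rate is 0, and the right side vanishes by [pre_weight_full]. *)
have [eJ|] := ltnP (xi k) J; last first.
  move=> Je; have eJ : xi k = J :> nat by have := config_le xi k; lia.
  have := pre_weight_full hq (config_le eta k); rewrite /bond_weight eJ => e.
  rewrite subrr qint0 mulr0 mul0r.
  set x := pre_weight _ _ _ J in e *.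
  set y := qi (_ + 1 - J%:Z) in e *; set z := qi (_ - J%:Z) in e *.
  rewrite [RHS](_ : _ = x * y * z * (pre_weight q J (eta i)%:Z (xi i)
    * (\prod_(l | (l != i) && (l != k)) weight q J (eta l)%:Z (xi l))
    * q ^ expo eta xi * qi (xi i)%:Z * qi (J%:Z + 1 - (xi i)%:Z) * q ^ s)).
    by rewrite e !mul0r.
  by ring.
have e := prod_weight_move_r eta ik c0 eJ.
rewrite dual_DE expo_move_r // (_ : _ - _ + _ + _ = expo eta xi + s); last by lia.
rewrite expfzDr //.
set A := qi (J%:Z - (xi k)%:Z) in e *; set W := \prod_l _ in e *.
transitivity (A * W * (qi (xi i)%:Z * (q ^ expo eta xi * q ^ s))).
  by ring.
by rewrite e; ring.
Qed.

Lemma bond_duality eta xi i k : k = i.+1 :> nat ->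
  bond_generator q i k (fun eta => dual_D q eta xi) eta
  = bond_generator q i k (fun xi => dual_D q eta xi) xi.
Proof.
move=> ki.
have ik : i != k by rewrite -(inj_eq val_inj) /= ki neq_ltn ltnSn.
have hki : k != i by rewrite eq_sym.
(* The values of [s] come from [order_weight_succ] and [order_weight_pred]; the position term is
   [2 * J] or its opposite, as the sites are neighbours. *)
have rate1 := @rate_dual_D_l eta xi i k ((xi i)%:Z + (xi k)%:Z) ik.
have rate2 := @rate_dual_D_l eta xi k i (- ((xi i)%:Z + (xi k)%:Z)) hki.
have rate3 := @rate_dual_D_r eta xi i k (2 * J%:Z - ((eta i)%:Z + (eta k)%:Z)) ik.
have rate4 := @rate_dual_D_r eta xi k i
  (- (2 * J%:Z - ((eta i)%:Z + (eta k)%:Z))) hki.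
have sxi := order_weight_succ (fun l => (xi l)%:Z) ki.
have seta := order_weight_pred (fun l => (eta l)%:Z) ki.
have {}rate1 := rate1 ltac:(lia).
have {}rate2 := rate2 ltac:(lia).
have {}rate3 := rate3 ltac:(lia).
have {}rate4 := rate4 ltac:(lia).
rewrite !(bond_weightC _ _ k i) in rate2 rate4.
have D0 : dual_D q eta xi = bond_weight eta xi i k * q ^ expo eta xi
  * (qi ((eta i)%:Z + 1 - (xi i)%:Z) * qi ((eta k)%:Z + 1 - (xi k)%:Z)).
  by rewrite dual_DE (prod_weight_bond _ _ ik); ring.
have qnumB (zeta : config J L) j : qnum q (J - zeta j) = qi (J%:Z - (zeta j)%:Z).
  by rewrite qnumE -subzn ?config_le.
rewrite /bond_generator !qnumB !qnumE.
set M := bond_weight _ _ _ _ * _ in rate1 rate2 rate3 rate4 D0.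
set a := (eta i)%:Z in rate1 rate2 rate3 rate4 D0 *.
set b := (eta k)%:Z in rate1 rate2 rate3 rate4 D0 *.
set c := (xi i)%:Z in rate1 rate2 rate3 rate4 D0 *.
set e := (xi k)%:Z in rate1 rate2 rate3 rate4 D0 *.
set D1 := dual_D _ (move eta i k) _ in rate1 *.
set D2 := dual_D _ (move eta k i) _ in rate2 *.
set D3 := dual_D _ _ (move xi i k) in rate3 *.
set D4 := dual_D _ _ (move xi k i) in rate4 *.
set D := dual_D _ _ _ in D0 *.
have split12 (r x y d z : R) :
  r * x * y * (d - z) = r * (x * y * d) - r * (x * y) * z.
  by ring.
have split21 (r x y d z : R) :
  r * x * y * (d - z) = r * (y * x * d) - r * (x * y) * z.
  by ring.
rewrite split12 split21 split12 split21 {}rate1 {}rate2 {}rate3 {}rate4 {}D0.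
have factor r x z u : r * (M * x) - r * z * (M * u) = M * (r * (x - z * u)).
  by ring.
by rewrite !factor -!mulrDr !intS (two_site_duality a b c e J%:Z hq).
Qed.

Lemma asep_duality_D eta xi :
  asep_generator q (fun eta => dual_D q eta xi) eta
  = asep_generator q (fun xi => dual_D q eta xi) xi.
Proof.
apply: eq_bigr => i _; apply: eq_bigr => k /eqP ki; exact: bond_duality.
Qed.

Lemma asep_duality_D' eta xi :
  asep_generator q (fun eta => dual_D' q eta xi) eta
  = asep_generator q (fun xi => dual_D' q eta xi) xi.
Proof.
apply: eq_bigr => i _; apply: eq_bigr => k /eqP ki.
have ik : i != k by rewrite -(inj_eq val_inj) /= ki neq_ltn ltnSn.
have ki' : k != i by rewrite eq_sym.
(* The prefactor in [dual_D'E] depends on particle numbers only, so it factors out of both sides. *)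
have factor (p r x y z u : R) :
  r * (p * x - p * y) + z * (p * u - p * y) = p * (r * (x - y) + z * (u - y)).
  by ring.
rewrite /bond_generator !dual_D'E !sum_move // !factor; congr (_ * _).
exact: bond_duality.
Qed.

End Duality.
End Configurations.

(** * Transition probabilities of a Markov process on a finite space *)

Section MarkovSemigroup.
Context (R : realType) (E : finType) (d : measure_display)
  (Omega : measurableType d).
Variables (P : E -> probability Omega R) (X : R -> Omega -> E).
Hypothesis hX : markov_process P X.

Definition transition (t : R) (x z : E) : R := fine (P x [set w | X t w = z]).

Lemma transitionE t x z : 0 <= t -> P x [set w | X t w = z] = (transition t x z)%:E.
Proof.
by move=> t0; rewrite fineK // fin_num_measure //; exact: (markov_measurable hX).
Qed.

Lemma transition_ge0 t x z : 0 <= transition t x z.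
Proof. by rewrite fine_ge0. Qed.

Lemma expectation_transition (f : E -> R) t x : 0 <= t ->
  ('E_(P x)[fun w => f (X t w)])%E = (\sum_z transition t x z * f z)%:E.
Proof.
move=> t0; pose A z := [set w | X t w = z].
have mA z : measurable (A z) by exact: (markov_measurable hX).
rewrite unlock.
transitivity (\int[P x]_w \sum_z (f z)%:E * (\1_(A z) w)%:E)%E.
  apply: eq_integral => w _; rewrite (bigD1 (X t w)) //= big1 ?adde0.
    by rewrite indicE mem_set // mule1.
  by move=> z /eqP zX; rewrite indicE memNset ?mule0 // => /esym.
rewrite integral_sum //; last first.
  by move=> z; apply: integrableZl => //; exact: integrable_indic.
rewrite -sumEFin; apply: eq_bigr => z _.
rewrite integralZl //; last exact: integrable_indic.
rewrite integral_indic // setIT EFinM muleC; congr (_ * _)%E.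
exact: transitionE.
Qed.

Lemma transition_sum1 t x : 0 <= t -> \sum_z transition t x z = 1.
Proof.
move=> t0; have := expectation_transition (fun=> 1) x t0.
rewrite -[X in expectation _ X]/(cst 1) expectation_cst => -[->].
by apply: eq_bigr => z _; rewrite mulr1.
Qed.

Lemma chapman_kolmogorov s t x z : 0 <= s -> 0 <= t ->
  transition (s + t) x z = \sum_y transition s x y * transition t y z.
Proof.
move=> s0 t0; apply/EFin_inj; rewrite -transitionE ?addr_ge0 //.
have st y : (transition s x y * transition t y z)%:E
    = P x ([set w | X s w = y] `&` [set w | X (s + t) w = z]).
  have := markov_property hX x y z s0 t0 (A := setT) _; rewrite setTI => ->.
    by rewrite !transitionE.
  (* [setT] lies in the generated sigma-algebra as the complement of the empty set. *)
  by move=> M [[M0 MC _] _]; rewrite -(setD0 setT); exact: MC.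
rewrite -sumEFin; under eq_bigr do rewrite st.
have mB y : measurable ([set w | X s w = y] `&` [set w | X (s + t) w = z]).
  by apply: measurableI; apply: (markov_measurable hX); rewrite ?addr_ge0.
under eq_bigr do rewrite -expectation_indic // unlock.
rewrite -integral_sum //; last by move=> y; exact: integrable_indic.
rewrite -expectation_indic; last by apply: (markov_measurable hX); rewrite addr_ge0.
rewrite unlock; apply: eq_integral => w _.
(* Pointwise in w, only the term y = X s w of the sum of indicators survives. *)
rewrite (bigD1 (X s w)) //= big1 ?adde0; last first.
  by move=> y /eqP yX; rewrite indicE memNset // => -[/esym].
rewrite !indicE; congr (_%:R%:E); congr nat_of_bool.
by apply/idP/idP; rewrite !inE /=; [move=> h; split | case].
Qed.

Lemma transition_contraction t x (f : E -> R) (e : R) : 0 <= t ->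
  (forall z, `|f z| <= e) -> `|\sum_z transition t x z * f z| <= e.
Proof.
move=> t0 fe; apply: le_trans (ler_norm_sum _ _ _) _.
rewrite -[leRHS]mul1r -(transition_sum1 x t0) mulr_suml.
apply: ler_sum => z _; rewrite normrM ger0_norm ?transition_ge0 //.
by rewrite ler_wpM2l ?transition_ge0.
Qed.

Lemma generator_transition (G : (E -> R) -> E -> R) (f : E -> R) x :
  has_generator P X G ->
  (\sum_z transition t x z * f z - f x) / t @[t --> 0^'+] --> G f x.
Proof.
move=> hG; apply: cvg_trans (hG f x); apply: near_eq_cvg.
near=> t; rewrite expectation_transition //.
Unshelve. all: by end_near.
Qed.

End MarkovSemigroup.

(** * From duality of generators to duality of processes *)

Section SemigroupDuality.
Context (R : realType) (E : finType).
Variables (d : measure_display) (Omega : measurableType d)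
  (P : E -> probability Omega R) (X : R -> Omega -> E)
  (d' : measure_display) (Omega' : measurableType d')
  (P' : E -> probability Omega' R) (X' : R -> Omega' -> E).
Hypotheses (hX : markov_process P X) (hX' : markov_process P' X').

Local Notation p := (transition P X).
Local Notation p' := (transition P' X').

Definition duality_defect (D : E -> E -> R) (t : R) (x y : E) : R :=
  \sum_z p t x z * D z y - \sum_z p' t y z * D x z.

(* With S and S' the two semigroups and D read as a matrix, this is
   S_(s+t) D - D S'_(s+t)^T
     = S_s (S_t D - D S'_t^T) + (S_s D - D S'_s^T) S'_t^T. *)
Lemma duality_defectD (D : E -> E -> R) (s t : R) x y : 0 <= s -> 0 <= t ->
  duality_defect D (s + t) x y
  = \sum_z p s x z * duality_defect D t z y
    + \sum_z p' t y z * duality_defect D s x z.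
Proof.
move=> s0 t0; rewrite /duality_defect.
under eq_bigr do rewrite (chapman_kolmogorov hX) // mulr_suml.
under [X in _ - X]eq_bigr do rewrite addrC (chapman_kolmogorov hX') // mulr_suml.
under [X in _ = X + _]eq_bigr do rewrite mulrBr.
under [X in _ = _ + X]eq_bigr do rewrite mulrBr.
rewrite !sumrB.
have -> : \sum_z p s x z * (\sum_w p' t y w * D z w)
    = \sum_z p' t y z * (\sum_w p s x w * D w z).
  under eq_bigr do rewrite mulr_sumr.
  rewrite exchange_big; apply: eq_bigr => z _; rewrite mulr_sumr.
  by apply: eq_bigr => w _; rewrite mulrCA.
rewrite addrA subrK; congr (_ - _); rewrite exchange_big; apply: eq_bigr => z _.
  by rewrite mulr_sumr; apply: eq_bigr => w _; rewrite mulrA.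
by rewrite mulr_sumr; apply: eq_bigr => w _; rewrite mulrA.
Qed.

(** By [duality_defectD] and contraction each further step adds at most [e]. The induction starts at
    one step, so the defect at time 0 never enters. *)
Lemma duality_defect_iter (D : E -> E -> R) (h e : R) (n : nat) x y : 0 <= h ->
  (forall x y, `|duality_defect D h x y| <= e) ->
  `|duality_defect D (n.+1%:R * h) x y| <= n.+1%:R * e.
Proof.
move=> h0 he; elim: n x y => [|n IHn] x y; first by rewrite !mul1r.
have nh0 : 0 <= n.+1%:R * h by rewrite mulr_ge0.
rewrite -[n.+2%:R]natr1 !mulrDl !mul1r duality_defectD //.
rewrite [leRHS]addrC; apply: le_trans (ler_normD _ _) _.
by apply: lerD; apply: transition_contraction.
Qed.

Lemma generator_duality (G : (E -> R) -> E -> R) (D : E -> E -> R) :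
  has_generator P X G -> has_generator P' X' G ->
  (forall x y, G (fun x => D x y) x = G (fun y => D x y) y) ->
  duality_function P X P' X' D.
Proof.
move=> hG hG' GD x y t t0; have t0' := ltW t0.
rewrite (expectation_transition hX (fun z => D z y)) //.
rewrite (expectation_transition hX' (fun z => D x z)) //.
congr (_%:E); apply/eqP; rewrite -subr_eq0 -normr_le0.
rewrite -/(duality_defect D t x y).
apply/ler_addgt0Pr => e e0; rewrite add0r.
(* The tolerance [e / t] per unit of time sums to [e] over the time [t]; finiteness of [E] makes the
   bound uniform in the pair of states. *)
have small : \forall h \near 0^'+, forall z : E * E,
    `|duality_defect D h z.1 z.2| <= h * (e / t).
  apply: filter_forall => -[u v] /=.
  have c1 := generator_transition hX (f := fun z => D z v) (x := u) hG.
  have c2 := generator_transition hX' (f := fun z => D u z) (x := v) hG'.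
  (* By [GD] the two derivatives at 0 cancel, so the defect divided by h tends to 0. *)
  have := cvgB c1 c2; rewrite GD subrr => /(_ _)/cvgr0Pnorm_le /(_ (e / t)).
  rewrite divr_gt0 // => /(_ isT); apply: filter_app; near=> h => /=.
  have h0 : 0 < h by near: h; exact: nbhs_right_gt.
  rewrite -mulrBl normrM normfV (gtr0_norm h0) ler_pdivrMr // mulrC.
  rewrite (_ : duality_defect D h u v =
    \sum_z p h u z * D z v - D u v - (\sum_z p' h v z * D u z - D u v)) //.
  by rewrite /duality_defect; ring.
move: small => /nbhs_ballP[r /= r0 small].
(* This [n] satisfies t / r < n + 1, so the step [h] falls within the radius [r]. *)
pose n := Num.truncn (t / r); pose h := t / n.+1%:R.
have h0 : 0 < h by rewrite divr_gt0.
have hr : h < r by rewrite ltr_pdivrMr // mulrC -ltr_pdivrMr // truncnS_gt.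
have tE : t = n.+1%:R * h by rewrite mulrC divfK.
have hs u v : `|duality_defect D h u v| <= h * (e / t).
  by apply: (small h _ h0 (u, v)); rewrite /ball /= sub0r normrN gtr0_norm.
rewrite tE (le_trans (duality_defect_iter n _ _ (ltW h0) hs)) //.
by rewrite mulrA -tE mulrC divfK // gt_eqF.
Unshelve. all: by end_near.
Qed.

End SemigroupDuality.

Theorem theorem3p2 (R : realType) (q : R) (hq : 0 < q < 1)
    (J : nat) (hJ : (0 < J)%N) (L : nat) (hL : (0 < L)%N)
    (d : measure_display) (Omega : measurableType d)
    (P : config J L -> probability Omega R) (X : R -> Omega -> config J L)
    (hX : markov_process P X) (hXG : has_generator P X (@asep_generator R q J L))
    (d' : measure_display) (Omega' : measurableType d')
    (P' : config J L -> probability Omega' R) (X' : R -> Omega' -> config J L)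
    (hX' : markov_process P' X')
    (hXG' : has_generator P' X' (@asep_generator R q J L)) :
  duality_function P X P' X' (@dual_D R q J L) /\
  duality_function P X P' X' (@dual_D' R q J L).
Proof.
split; apply: (generator_duality hX hX' hXG hXG') => eta xi.
  exact: asep_duality_D.
exact: asep_duality_D'.
Qed.
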